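(* Let $L$ be a semi-simple locally finite Lie algebra over a field of characteristic zero such that for every finite set $x_1,x_2,\ldots,x_k\in L$ there is a finite-dimensional subalgebra $A$ of $L$ which contains these elements and for which $L(\operatorname{ad}A)^n\subset A$ for some positive integer $n$. Then $L$ is a subdirect sum of a set of finite-dimensional simple Lie algebras.
   Context: $\operatorname{ad}a$ is the map $x\mapsto[x,a]$ of $L$, and $L(\operatorname{ad}A)^n$ is the linear span of all $[\ldots[[x,a_1],a_2],\ldots,a_n]$ with $x\in L$, $a_i\in A$. A Lie algebra is locally finite if every finite subset is contained in a finite-dimensional subalgebra; locally solvable if every finite subset is contained in a solvable subalgebra; semi-simple if it has no non-zero locally solvable ideals. $L$ is a subdirect sum of a set of Lie algebras $\{L_\alpha\}$ if $L$ is isomorphic to a subalgebra of the complete direct sum (direct product) $\prod_\alpha L_\alpha$ whose projection onto each $L_\alpha$ is surjective. *)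

(* Defs.v *)
From HB Require Import structures.
From mathcomp Require Import all_boot all_algebra.
From mathcomp Require Import boolp classical_sets functions cardinality.

Set Implicit Arguments.
Unset Strict Implicit.
Unset Printing Implicit Defensive.

Import GRing.Theory.

Local Open Scope classical_set_scope.
Local Open Scope ring_scope.

HB.mixin Record Lmodule_isLieAlgebra (K : fieldType) L
    of GRing.Lmodule K L := {
  lie : L -> L -> L;
  lie_linearl : forall y, linear (fun x => lie x y);
  lie_linearr : forall x, linear (lie x);
  liexx : forall x, lie x x = 0;
  lie_jacobi : forall x y z,
    lie x (lie y z) + lie y (lie z x) + lie z (lie x y) = 0
}.

#[short(type="lieAlgType")]
HB.structure Definition LieAlgebra (K : fieldType) :=
  {L of GRing.Lmodule K L & Lmodule_isLieAlgebra K L}.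

Notation "⟦ x , y ⟧" := (lie x y) (at level 0, x at level 99, y at level 99,
  format "⟦ x ,  y ⟧") : ring_scope.

Section Subspaces.
Context {K : fieldType} {V : lmodType K}.

Definition subspace (A : set V) : Prop :=
  A 0 /\ forall (a : K) x y, A x -> A y -> A (a *: x + y).

Definition lspan (X : set V) : set V := smallest subspace X.

Definition findim (A : set V) : Prop :=
  exists s : seq V, A = lspan [set` s].

End Subspaces.

Section LieNotions.
Context {K : fieldType} {L : lieAlgType K}.
Implicit Types A I : set L.

Definition subalgebra A : Prop :=
  subspace A /\ forall x y, A x -> A y -> A ⟦x, y⟧.

Definition ideal I : Prop :=
  subspace I /\ forall x y, I x -> I ⟦x, y⟧.

Definition ad (a : L) : L -> L := fun x => ⟦x, a⟧.

Definition ad_power A (n : nat) : set L :=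
  lspan [set y | exists x (s : n.-tuple L),
    [set` s] `<=` A /\ y = foldl (fun z a => ad a z) x s].

Definition lie_commutator A B : set L :=
  lspan [set z | exists x y, [/\ A x, B y & z = ⟦x, y⟧]].

Definition derived_series A (n : nat) : set L :=
  iter n (fun B => lie_commutator B B) A.

Definition solvable A : Prop := exists n, derived_series A n = [set 0].

Definition locally_solvable A : Prop :=
  forall X : set L, finite_set X -> X `<=` A ->
    exists B, [/\ subalgebra B, B `<=` A, solvable B & X `<=` B].

End LieNotions.

Definition locally_finite (K : fieldType) (L : lieAlgType K) : Prop :=
  forall X : set L, finite_set X ->
    exists A, [/\ subalgebra A, findim A & X `<=` A].

Definition semisimple (K : fieldType) (L : lieAlgType K) : Prop :=
  forall I : set L, ideal I -> locally_solvable I -> I = [set 0].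

(* As usual, simple Lie algebras are required to be non-abelian. *)
Definition simple (K : fieldType) (L : lieAlgType K) : Prop :=
  (exists x y : L, ⟦x, y⟧ != 0) /\
  forall I : set L, ideal I -> I = [set 0] \/ I = setT.

Definition lie_morphism (K : fieldType) (L M : lieAlgType K) (f : L -> M) :=
  linear f /\ {morph f : x y / ⟦x, y⟧}.

(* The index type is arbitrary, so equality and choice on the product come
   from the classical instances on dependent functions in boolp. *)
Definition lie_prod (K : fieldType) (J : Type) (S : J -> lieAlgType K) : Type :=
  forall j, S j.

Section LieProduct.
Context (K : fieldType) (J : Type) (S : J -> lieAlgType K).
Local Notation P := (lie_prod S).
Implicit Types x y z : P.

HB.instance Definition _ := Choice.copy P (forall j, S j).

Definition lie_prod_zero : P := fun=> 0.
Definition lie_prod_opp x : P := fun j => - x j.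
Definition lie_prod_add x y : P := fun j => x j + y j.
Definition lie_prod_scale (a : K) x : P := fun j => a *: x j.
Definition lie_prod_lie x y : P := fun j => ⟦x j, y j⟧.

Fact lie_prod_addA : associative lie_prod_add.
Proof. by move=> x y z; apply: functional_extensionality_dep => j; exact: addrA. Qed.
Fact lie_prod_addC : commutative lie_prod_add.
Proof. by move=> x y; apply: functional_extensionality_dep => j; exact: addrC. Qed.
Fact lie_prod_add0 : left_id lie_prod_zero lie_prod_add.
Proof. by move=> x; apply: functional_extensionality_dep => j; exact: add0r. Qed.
Fact lie_prod_addN : left_inverse lie_prod_zero lie_prod_opp lie_prod_add.
Proof. by move=> x; apply: functional_extensionality_dep => j; exact: addNr. Qed.

HB.instance Definition _ := GRing.isZmodule.Build P
  lie_prod_addA lie_prod_addC lie_prod_add0 lie_prod_addN.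

Fact lie_prod_scaleA a b x :
  lie_prod_scale a (lie_prod_scale b x) = lie_prod_scale (a * b) x.
Proof. by apply: functional_extensionality_dep => j; exact: scalerA. Qed.
Fact lie_prod_scale1 : left_id 1 lie_prod_scale.
Proof. by move=> x; apply: functional_extensionality_dep => j; exact: scale1r. Qed.
Fact lie_prod_scaleDr : right_distributive lie_prod_scale +%R.
Proof. by move=> a x y; apply: functional_extensionality_dep => j; exact: scalerDr. Qed.
Fact lie_prod_scaleDl x :
  {morph lie_prod_scale^~ x : a b / a + b >-> a + b}.
Proof. by move=> a b; apply: functional_extensionality_dep => j; exact: scalerDl. Qed.

HB.instance Definition _ := GRing.Zmodule_isLmodule.Build K P
  lie_prod_scaleA lie_prod_scale1 lie_prod_scaleDr lie_prod_scaleDl.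

Fact lie_prod_linearl y : linear (fun x => lie_prod_lie x y).
Proof.
by move=> a x z; apply: functional_extensionality_dep => j; exact: lie_linearl.
Qed.
Fact lie_prod_linearr x : linear (lie_prod_lie x).
Proof.
by move=> a y z; apply: functional_extensionality_dep => j; exact: lie_linearr.
Qed.
Fact lie_prod_xx x : lie_prod_lie x x = 0.
Proof. by apply: functional_extensionality_dep => j; exact: liexx. Qed.
Fact lie_prod_jacobi x y z :
  lie_prod_lie x (lie_prod_lie y z) + lie_prod_lie y (lie_prod_lie z x)
    + lie_prod_lie z (lie_prod_lie x y) = 0.
Proof. by apply: functional_extensionality_dep => j; exact: lie_jacobi. Qed.

HB.instance Definition _ := Lmodule_isLieAlgebra.Build K P
  lie_prod_linearl lie_prod_linearr lie_prod_xx lie_prod_jacobi.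

End LieProduct.

Definition subdirect_sum (K : fieldType) (L : lieAlgType K)
    (J : Type) (S : J -> lieAlgType K) : Prop :=
  exists M : set (lie_prod S), [/\ subalgebra M,
    forall j, [set x j | x in M] = [set: S j] &
    exists f : L -> lie_prod S, lie_morphism f /\ set_bij setT M f].

(* Main.v *)
Require Import Defs.
From HB Require Import structures.
From mathcomp Require Import all_boot all_algebra.
From mathcomp Require Import boolp classical_sets functions cardinality.
From mathcomp Require Import fieldext ring.

Set Implicit Arguments.
Unset Strict Implicit.
Unset Printing Implicit Defensive.

Import GRing.Theory Num.Theory.

Local Open Scope classical_set_scope.
Local Open Scope ring_scope.

(** The simple quotients of [L] come from its finite-dimensional minimal ideals.

    Let [M] be such an ideal.  Since [L] has no non-zero abelian ideal, [M] is
    perfect.  The radical of the form [killing x y = tr (ad x ad y)], traces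
    being taken on [M], is an ideal of [L] inside [M], hence [0] or [M].  It
    cannot be [M]: by Cartan's argument ([trace_form_nilpotent]) every [ad x]
    with [x] in [M] would be nilpotent on [M], by [engel] the lower central
    series of [M] would reach [0], and [M] is perfect.  So the form is
    nondegenerate on [M], and representing [killing z] on [M] by an element of
    [M], for each [z] in [L], gives [L = M + C(M)], where [C(M)] is the
    centraliser ([complement_centralises]).  As [C(M)] acts trivially on [M],
    the ideals of the Lie algebra [M] are ideals of [L], so [M] is simple, and
    [L / C(M)] is isomorphic to [M] ([minimal_ideal_quotient]).

    It remains to see that the ideal [N], the intersection of all the [C(M)],
    vanishes; it suffices that [N] is locally solvable.  Given a finite subset
    of [N], let [A] be a finite-dimensional subalgebra containing it with
    [L (ad A)^n] inside [A].  The decreasing sequence [W k = L (ad A)^k] is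
    eventually inside [A], so it becomes stationary, and its final value [W] is
    an ideal of [L] ([stable_term]): an element of [W n (ad A)^j] is an iterated
    bracket of [j + 1] elements of [A], so bracketing with it moves [L] into
    [W (j + 1)].  If [W] met [N] non-trivially, their intersection would contain
    a minimal ideal [M] centralised by [N], hence an abelian one.  So [W] and
    [N] meet in [0], and since the [k]-th derived algebra of the intersection of
    [A] and [N] lies in both [W k] and [N], that intersection is solvable.

    Cartan's argument for [x] in a linear Lie algebra with zero trace form: over
    a splitting field, split the space into generalised eigenspaces of [x] with
    projections [f i] and eigenvalues [l i].  For a map [c] on eigenvalues that
    respects equalities of differences, [S = sum_i c i f i] satisfies
    [ [S, G] <= G ], because [ [S, _] ] acts as a scalar on each generalised
    eigenspace of [ad x] ([graded_multiplier]).  As [x] is a sum of commutators,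
    [tr (S x) = 0], that is [sum_i c i (l i) rank (f i) = 0].  Taking for [c]
    all the [Q]-linear functionals on the [Q]-span of the [l i] forces [l i = 0]
    ([rational_functional]). *)

(** * Fields of characteristic zero and splitting fields *)


(** Non-zero integers are invertible in [E], so [ratr] is a morphism although
    [E] carries no order. *)
Lemma rat_rmorphism (E : fieldType) :
  [pchar E] =i pred0 -> inhabited {rmorphism rat -> E}.
Proof.
move=> E0.
have intr0 (z : int) : (z%:~R == 0 :> E) = (z == 0).
  have natr0 n : (n%:R == 0 :> E) = (n == 0%N) by move/pcharf0P: E0.
  by case: z => n; rewrite ?NegzE ?mulrNz ?oppr_eq0 -?pmulrn natr0.
(* [ratr x] can be computed from any fraction representing [x], not only from
   the reduced one. *)
have ratrP x (n d : int) : d != 0 -> x * d%:~R = n%:~R ->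
    ratr x * d%:~R = n%:~R :> E.
  move=> d0 xd; have den0 : (denq x)%:~R != 0 :> E by rewrite intr0 denq_neq0.
  apply: (mulfI den0); rewrite mulrA [_ * ratr x]mulrC divfK // -!intrM.
  congr _%:~R; apply: (@intr_inj rat); rewrite !intrM numqE mulrAC xd.
  exact: mulrC.
have den0 x : (denq x)%:~R != 0 :> E by rewrite intr0 denq_neq0.
have ratrE x : ratr x * (denq x)%:~R = (numq x)%:~R :> E by rewrite divfK.
have fB : zmod_morphism (@ratr E).
  move=> x y; apply: (mulIf (mulf_neq0 (den0 x) (den0 y))); rewrite -intrM.
  rewrite (ratrP _ (numq x * denq y - numq y * denq x)).
  - rewrite intrB !intrM -!ratrE mulrBl; congr (_ - _); first by rewrite mulrA.
    by rewrite -mulrA [X in _ * X]mulrC.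
  - by rewrite mulf_neq0 ?denq_neq0.
  rewrite intrB !intrM !numqE mulrBl; congr (_ - _); first by rewrite mulrA.
  by rewrite -mulrA [X in _ * X]mulrC.
have fM : monoid_morphism (@ratr E).
  split=> [|x y]; first by rewrite /ratr divr1.
  apply: (mulIf (mulf_neq0 (den0 x) (den0 y))); rewrite -intrM.
  rewrite (ratrP _ (numq x * numq y)).
  - by rewrite intrM -!ratrE mulrACA intrM.
  - by rewrite mulf_neq0 ?denq_neq0.
  by rewrite !intrM !numqE mulrACA.
pose aM := GRing.isZmodMorphism.Build rat E (@ratr E) fB.
pose mM := GRing.isMonoidMorphism.Build rat E (@ratr E) fM.
by pose f : {rmorphism rat -> E} := HB.pack (@ratr E) aM mM; exists.
Qed.

Lemma irreducible_divisor (F : fieldType) (p : {poly F}) :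
  (1 < size p)%N -> exists2 q, irreducible_poly q & q %| p.
Proof.
have [n] := ubnP (size p); elim: n p => // n IHn p; rewrite ltnS => le_pn p_gt1.
have p0 : p != 0 by rewrite -size_poly_gt0 ltnW.
have [irr|] := pselect (irreducible_poly p); first by exists p.
move=> red.
have [q [q1 qp nqp]] : exists q : {poly F},
    [/\ size q != 1%N, q %| p & ~~ (q %= p)].
  apply: contrapT => no; apply: red; split=> // q q1 qp.
  by apply/negP => /negP nqp; apply: no; exists q.
have q_gt1 : (1 < size q)%N.
  rewrite ltn_neqAle eq_sym q1 size_poly_gt0.
  by apply: contraTneq qp => ->; rewrite dvd0p.
have lt_qp : (size q < size p)%N.
  rewrite ltn_neqAle dvdp_leq // andbT; move: nqp.
  by rewrite -(dvdp_size_eqp qp).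
have [r irr rq] := IHn q (leq_trans lt_qp le_pn) q_gt1.
by exists r => //; apply: dvdp_trans qp.
Qed.

(** Adjoin a root of an irreducible factor, divide it out, and recurse on the
    degree of the remaining factor over the larger field. *)
Lemma splitting_extension (F : fieldType) (p : {poly F}) : p \is monic ->
  exists (E : fieldType) (f : {rmorphism F -> E}) (t : seq E),
    map_poly f p = \prod_(a <- t) ('X - a%:P).
Proof.
move sz: (size p) => n.
elim: n F p sz => [|n IHn] F p sz p_mon.
  by move: (monic_neq0 p_mon); rewrite -size_poly_eq0 sz.
case: n => [|n] in IHn sz *.
  exists F, idfun, [::]; rewrite big_nil map_poly_id //.
  move/eqP: sz => /size_poly1P [c _ pc]; move: p_mon.
  by rewrite pc monicE lead_coefC => /eqP->.
have [q irr qp] : exists2 q, irreducible_poly q & q %| p.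
  by apply: irreducible_divisor; rewrite sz.
have [E _ [z qz _]] := irredp_FAdjoin irr.
have : root (map_poly (in_alg E) p) z.
  rewrite -dvdp_XsubCl (dvdp_trans _ (_ : map_poly (in_alg E) q %| _)) //.
    by rewrite dvdp_XsubCl.
  by rewrite dvdp_map.
case/factor_theorem => p' p'E.
have pE_mon : map_poly (in_alg E) p \is monic by rewrite monic_map.
have p'_mon : p' \is monic.
  by move: pE_mon; rewrite p'E monicMr ?monicXsubC.
have sz' : size p' = n.+1.
  have := size_map_poly (in_alg E) p.
  rewrite p'E size_Mmonic ?monicXsubC ?monic_neq0 // size_XsubC sz addn2.
  by case.
have [E' [f [t ft]]] := IHn E p' sz' p'_mon.
exists E', (f \o in_alg E), (f z :: t).
rewrite map_poly_comp p'E rmorphM /= ft big_cons mulrC; congr (_ * _).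
by rewrite rmorphB /= map_polyX map_polyC.
Qed.

(** * Traces and spectral idempotents *)
Section Traces.
Variables (F : fieldType) (n : nat).
Implicit Types A : 'M[F]_n.+1.

(** From [A ^+ k = 0], the matrix ['X - A] divides [('X ^+ k)%:M], so the
    characteristic polynomial divides a power of ['X] and is itself a power of
    ['X]; the trace is one of its lower coefficients. *)
Lemma mxtrace_nilpotent A k : A ^+ k = 0 -> \tr A = 0.
Proof.
move=> Ak0; pose B : 'M[{poly F}]_n.+1 := map_mx polyC A.
have Bk0 : B ^+ k = 0 by rewrite -rmorphXn Ak0 /= map_mx0.
have /dvdp_exp_XsubCP[j _] : char_poly A %| ('X - 0%:P) ^+ (n.+1 * k).
  have cXB : GRing.comm ('X%:M) B by rewrite /GRing.comm -!mulmxE scalar_mxC.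
  have XB := subrXX_comm k cXB; rewrite Bk0 subr0 in XB.
  have := congr1 determinant XB.
  rewrite -rmorphXn det_scalar det_mulmx subr0 -exprM mulnC => ->.
  exact: dvdp_mulIl.
rewrite subr0 eqp_monic ?char_poly_monic ?monicXn // => /eqP cA.
have := size_char_poly A; rewrite cA size_polyXn => -[jn].
have := char_poly_trace A isT; rewrite cA jn coefXn /= ltn_eqF // => /esym/eqP.
by rewrite oppr_eq0 => /eqP.
Qed.

(** A rank factorisation [A = C R] of an idempotent satisfies [R C = 1], and
    [tr (C R) = tr (R C)]. *)
Lemma mxtrace_idempotent A : A * A = A -> \tr A = (\rank A)%:R.
Proof.
move=> AA; have := mulmx_base A.
move: (row_base A) (row_base_free A) (col_base A) (col_base_full A).
move=> R R_free C C_full CR.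
suff RC : R *m C = 1%:M by rewrite -{1}CR mxtrace_mulC RC mxtrace1.
apply: (row_free_inj R_free); apply: (row_full_inj C_full).
by rewrite /= mul1mx !mulmxA CR -mulmxA CR mulmxE.
Qed.
End Traces.

(** Chinese remainders for the powers [('X - a) ^+ k].  Evaluated at a matrix
    killed by their product, the [e a] become the projections onto the
    generalised eigenspaces: they add up to [1] and are orthogonal, hence
    idempotent. *)
Lemma spectral_partition (F : fieldType) (s : seq F) (k : nat) : uniq s ->
  exists e : F -> {poly F},
    [/\ \prod_(a <- s) ('X - a%:P) ^+ k %| 1 - \sum_(a <- s) e a,
        {in s, forall a,
          \prod_(b <- s) ('X - b%:P) ^+ k %| e a * ('X - a%:P) ^+ k} &
        {in s &, forall a b, a != b ->
          \prod_(c <- s) ('X - c%:P) ^+ k %| e a * e b}].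
Proof.
move=> s_uniq.
suff [e [sum_e kill_e]] : exists e : F -> {poly F},
    \prod_(a <- s) ('X - a%:P) ^+ k %| 1 - \sum_(a <- s) e a /\
    {in s, forall a, \prod_(b <- s) ('X - b%:P) ^+ k %| e a * ('X - a%:P) ^+ k}.
  exists e; split=> // a b /kill_e kill_a /kill_e kill_b ab.
  (* Orthogonality follows from the annihilation property and coprimality. *)
  have /Bezout_eq1_coprimepP[[u v] /= uv] :
      coprimep (('X - a%:P) ^+ k) (('X - b%:P) ^+ k).
    by rewrite coprimep_expl ?coprimep_expr ?coprimep_XsubC2 // subr_eq0 eq_sym.
  have -> : e a * e b = e b * u * (e a * ('X - a%:P) ^+ k) +
      e a * v * (e b * ('X - b%:P) ^+ k) by rewrite -[LHS]mulr1 -uv; ring.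
  by rewrite dvdp_add // dvdp_mull.
elim: s s_uniq => [_|b s IHs /andP[b_s /IHs[e [sum_e kill_e]]]].
  by exists (fun=> 0); rewrite !big_nil dvd1p; split=> // a.
rewrite !big_cons; set p := ('X - b%:P) ^+ k.
have /Bezout_eq1_coprimepP[[u v] /= uv] :
    coprimep p (\prod_(a <- s) ('X - a%:P) ^+ k).
  rewrite /p coprimep_expl //; elim: s b_s {IHs e sum_e kill_e} => [|a s IHs].
    by rewrite big_nil coprimep1.
  rewrite inE negb_or => /andP[ba /IHs cs].
  rewrite big_cons coprimepMr cs andbT.
  by rewrite coprimep_expr // coprimep_XsubC2 // subr_eq0 eq_sym.
set P := \prod_(a <- s) _ in sum_e kill_e uv *.
exists (fun a => if a == b then v * P else e a * (u * p)).
rewrite !big_cons -/P -/p eqxx; split.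
  rewrite (eq_big_seq (fun a => e a * (u * p))) => [|a a_s]; last first.
    by rewrite ifN //; apply: contraNneq b_s => <-.
  have -> : 1 - (v * P + \sum_(a <- s) e a * (u * p)) =
      (u * p) * (1 - \sum_(a <- s) e a).
    by rewrite -mulr_suml -{1}uv; ring.
  by rewrite -mulrA dvdp_mull // dvdp_mul.
move=> a; rewrite inE; case: eqP => [-> _ | _ /= a_s].
  have -> : v * P * ('X - b%:P) ^+ k = v * (p * P) by rewrite /p; ring.
  exact: dvdp_mull.
have -> : e a * (u * p) * ('X - a%:P) ^+ k = u * (p * (e a * ('X - a%:P) ^+ k)).
  by ring.
by rewrite dvdp_mull // dvdp_mul // kill_e.
Qed.

(** * Subspaces and spans *)
Lemma linear_at0 (K : fieldType) (U V : lmodType K) (f : U -> V) :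
  linear f -> f 0 = 0.
Proof.
by move=> lin; have := lin (-1) 0 0; rewrite scaler0 addr0 scaleN1r addNr.
Qed.

Section SubspaceTheory.
Context {K : fieldType} {V : lmodType K}.
Implicit Types (A B X : set V).

Lemma subspaceD A x y : subspace A -> A x -> A y -> A (x + y).
Proof. by move=> [_ AZ] Ax Ay; rewrite -[x]scale1r; apply: AZ. Qed.

Lemma subspaceZ A a x : subspace A -> A x -> A (a *: x).
Proof. by move=> [A0 AZ] Ax; rewrite -[_ *: _]addr0; apply: AZ. Qed.

Lemma subspaceN A x : subspace A -> A x -> A (- x).
Proof. by move=> sA Ax; rewrite -scaleN1r; apply: subspaceZ. Qed.

Lemma subspaceB A x y : subspace A -> A x -> A y -> A (x - y).
Proof. by move=> sA Ax Ay; apply: subspaceD => //; apply: subspaceN. Qed.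

Lemma subspace_sum A (I : Type) (r : seq I) (P : pred I) (F : I -> V) :
  subspace A -> (forall i, P i -> A (F i)) -> A (\sum_(i <- r | P i) F i).
Proof.
move=> sA AF; apply: big_ind => //; first by case: sA.
by move=> x y; apply: subspaceD.
Qed.

Lemma lspan_subspace X : subspace (lspan X).
Proof.
split=> [B [[B0 _] _] // | a x y Xx Xy B BX].
by case: (BX) => -[_ BZ] _; apply: BZ; [apply: Xx | apply: Xy].
Qed.

Lemma sub_lspan X : X `<=` lspan X.
Proof. exact: sub_gen_smallest. Qed.

Lemma lspan_min X A : subspace A -> X `<=` A -> lspan X `<=` A.
Proof. by move=> sA XA; apply: smallest_sub. Qed.

Lemma subspace0 : subspace [set 0 : V].
Proof. by split=> // a _ _ -> ->; rewrite scaler0 addr0. Qed.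

Lemma subspaceI A B : subspace A -> subspace B -> subspace (A `&` B).
Proof.
move=> [A0 AZ] [B0 BZ]; split=> // a x y [Ax Bx] [Ay By].
by split; [apply: AZ | apply: BZ].
Qed.

End SubspaceTheory.

Lemma subspace_preimage (K : fieldType) (U V : lmodType K) (f : U -> V)
    (A : set V) :
  linear f -> subspace A -> subspace [set u | A (f u)].
Proof.
move=> lin sA; split=> [|a x y Ax Ay] /=; last by rewrite lin; apply: sA.2.
by rewrite (linear_at0 lin); apply: sA.1.
Qed.

Lemma subspace_image (K : fieldType) (U V : lmodType K) (f : U -> V)
    (A : set U) :
  linear f -> subspace A -> subspace [set f u | u in A].
Proof.
move=> lin [A0 AZ]; split; first by exists 0 => //; apply: linear_at0.
move=> a _ _ [u Au <-] [v Av <-]; exists (a *: u + v); rewrite ?lin //.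
exact: AZ.
Qed.

Lemma lspan_bilinear (K : fieldType) (U V W : lmodType K) (b : U -> V -> W)
    (X : set U) (Y : set V) (A : set W) :
  (forall y, linear (b^~ y)) -> (forall x, linear (b x)) -> subspace A ->
  (forall x y, X x -> Y y -> A (b x y)) ->
  forall x y, lspan X x -> lspan Y y -> A (b x y).
Proof.
move=> bl br sA XYA x y Xx.
apply: (lspan_min (subspace_preimage (br x) sA)) => {}y Yy.
move: x Xx; apply: (lspan_min (subspace_preimage (bl y) sA)) => x Xx.
exact: XYA.
Qed.

(** A matrix of maximal rank among those with all rows in [A] must span [A]. *)
Lemma subspace_rowspace (F : fieldType) (m : nat) (A : set 'rV[F]_m) :
  subspace A -> exists W : 'M[F]_m, forall r, A r <-> (r <= W)%MS.
Proof.
move=> sA.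
pose inA (W : 'M[F]_m) := forall r : 'rV_m, (r <= W)%MS -> A r.
have inA0 : inA 0 by move=> r; rewrite submx0 => /eqP->; case: sA.
pose P k := `[< exists2 W, inA W & \rank W = k >].
have exP : exists k, P k.
  by exists (\rank (0 : 'M[F]_m)); apply/asboolP; exists 0.
have leP k : P k -> (k <= m)%N by move=> /asboolP[W _ <-]; apply: rank_leq_row.
case: (ex_maxnP exP leP) => k /asboolP[W WA rkW] max_k.
exists W => r; split=> [Ar|]; last exact: WA.
have /max_k : P (\rank (W + r)%MS).
  apply/asboolP; exists (W + r)%MS => // s /sub_addsmxP[[u v] /= ->].
  apply: subspaceD => //; first by apply: WA; apply: submxMl.
  have [c ->] : exists c, v *m r = c *: r.
    by exists (v 0 0); rewrite [v]mx11_scalar mul_scalar_mx !mxE eqxx mulr1n.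
  exact: subspaceZ.
rewrite -rkW => le_rk.
have [_] := mxrank_leqif_sup (addsmxSl W r).
rewrite eqn_leq le_rk mxrankS ?addsmxSl //= => /esym.
exact/submx_trans/addsmxSr.
Qed.

(** * Rational functionals *)

(** Taking for [c] the rational functionals on the [Q]-span of the [l i], the
    hypothesis reads [sum_i n i c(l i) l i = 0]; applying [c] once more gives
    [sum_i n i c(l i)^2 = 0] in [Q], so every functional kills [l i] when
    [n i > 0].  The functionals are handled as the vectors killed by the
    relation space [W] of the [l i], which avoids choosing a basis of the span.
    *)
Lemma rational_functional (E : fieldType) (m : nat) (l : 'I_m -> E)
    (n : 'I_m -> nat) : [pchar E] =i pred0 ->
  (forall c : 'I_m -> E,
     (forall i j i' j', l i - l j = l i' - l j' -> c i - c j = c i' - c j') ->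
     \sum_i c i * (l i *+ n i) = 0) ->
  forall i, (0 < n i)%N -> l i = 0.
Proof.
move=> /rat_rmorphism[f] no_functional i0 ni0.
have sub_rel : subspace [set r : 'rV[rat]_m | \sum_i f (r 0 i) * l i = 0].
  split=> /= [|a r r' rl r'l].
    by rewrite big1 // => i _; rewrite mxE rmorph0 mul0r.
  rewrite (eq_bigr (fun i => f a * (f (r 0 i) * l i) + f (r' 0 i) * l i)).
    by rewrite big_split /= -mulr_sumr rl r'l mulr0 addr0.
  by move=> i _; rewrite !mxE rmorphD rmorphM mulrDl mulrA.
have [W relW] := subspace_rowspace sub_rel.
(* A column vector killed by [W] is a functional on the [Q]-span of [l]. *)
have killW (c : 'cV_m) : W *m c = 0 -> c i0 0 = 0.
  move=> Wc.
  have rel_c (r : 'rV_m) :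
      \sum_i f (r 0 i) * l i = 0 -> \sum_i r 0 i * c i 0 = 0.
    move/relW => /submxP[u rE].
    have : (r *m c) 0 0 = 0 by rewrite rE -mulmxA Wc mulmx0 mxE.
    by rewrite mxE.
  have /no_functional : forall i j i' j', l i - l j = l i' - l j' ->
      f (c i 0) - f (c j 0) = f (c i' 0) - f (c j' 0).
    move=> i j i' j' lE; rewrite -!rmorphB; congr (f _).
    apply/eqP; rewrite -subr_eq0.
    pose r : 'rV[rat]_m :=
      delta_mx 0 i - delta_mx 0 j - (delta_mx 0 i' - delta_mx 0 j').
    have pairing (F : fieldType) (h : {rmorphism rat -> F}) (b : 'I_m -> F) :
        \sum_k h (r 0 k) * b k = b i - b j - (b i' - b j').
      rewrite (eq_bigr (fun k => ((k == i)%:R * b k - (k == j)%:R * b k) -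
        ((k == i')%:R * b k - (k == j')%:R * b k))); last first.
        by move=> k _; rewrite !mxE !eqxx /= !rmorphB !rmorph_nat !mulrBl.
      have one k0 : \sum_k (k == k0)%:R * b k = b k0.
        rewrite (bigD1 k0) //= eqxx mul1r big1 ?addr0 // => k /negPf->.
        by rewrite mul0r.
      by rewrite sumrB !sumrB !one.
    by rewrite -(pairing _ idfun (c^~ 0)) rel_c // (pairing _ f) lE subrr.
  rewrite (eq_bigr (fun i => f ((\row_k (c k 0 *+ n k)) 0 i) * l i));
    last first.
    by move=> i _; rewrite mxE rmorphMn mulrnAl mulrnAr.
  move/rel_c/eqP; rewrite psumr_eq0; last first.
    by move=> i _; rewrite mxE mulrnAl mulrn_wge0 // -expr2 sqr_ge0.
  move/allP/(_ i0 (mem_index_enum _)); rewrite mxE mulrnAl mulrn_eq0 /=.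
  by rewrite -expr2 sqrf_eq0 -[n i0 == 0%N]negbK -lt0n ni0 => /eqP.
(* Double annihilator: the [i0]-th unit vector is orthogonal to everything
   orthogonal to [W], so it is a relation, namely [l i0 = 0]. *)
have d_W : ((delta_mx 0 i0 : 'rV_m) <= W)%MS.
  rewrite submxE -rowE; apply/eqP/rowP => j; rewrite [LHS]mxE [RHS]mxE.
  have <- := killW (col j (cokermx W)); first by rewrite [RHS]mxE.
  by rewrite colE mulmxA mulmx_coker mul0mx.
have /= := (relW _).2 d_W.
rewrite (bigD1 i0) //= mxE !eqxx rmorph1 mul1r big1 ?addr0 // => i /negPf i_i0.
by rewrite mxE i_i0 andbF rmorph0 mul0r.
Qed.

(** * Generalised eigenvectors and stable subspaces *)
Section Grading.
Context {K : fieldType} {V : lmodType K}.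
Variables (D : {linear V -> V}) (G : set V).
Hypotheses (subG : subspace G) (GD : forall v, G v -> G (D v)).

Definition shift (a : K) (v : V) := D v - a *: v.

Lemma shift_is_linear a : linear (shift a).
Proof.
move=> c u v; rewrite /shift linearP scalerDr scalerBr !scalerA [a * c]mulrC.
by rewrite opprD addrACA.
Qed.

Lemma iter_shiftD n a u v :
  iter n (shift a) (u + v) = iter n (shift a) u + iter n (shift a) v.
Proof.
elim: n => //= n ->; have := shift_is_linear a 1 (iter n (shift a) u).
by move=> lin; have := lin (iter n (shift a) v); rewrite !scale1r.
Qed.

Lemma iter_shift0 n a : iter n (shift a) 0 = 0.
Proof. by elim: n => //= n ->; rewrite /shift linear0 scaler0 subr0. Qed.

Lemma iter_shift_sum n a (I : Type) (r : seq I) (F : I -> V) :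
  iter n (shift a) (\sum_(i <- r) F i) = \sum_(i <- r) iter n (shift a) (F i).
Proof. exact: (big_morph _ (iter_shiftD n a) (iter_shift0 n a)). Qed.

Lemma shiftC a b v : shift a (shift b v) = shift b (shift a v).
Proof.
have DB u w : D (u - w) = D u - D w by apply: raddfB.
have DZ c w : D (c *: w) = c *: D w by apply: linearZ.
rewrite /shift !DB !DZ !scalerBr !scalerA [b * a]mulrC !opprB.
by rewrite addrACA [RHS]addrACA; congr (_ + _); apply: addrC.
Qed.

Lemma iter_shiftC m n a b v :
  iter m (shift a) (iter n (shift b) v) = iter n (shift b) (iter m (shift a) v).
Proof.
have step k w : shift a (iter k (shift b) w) = iter k (shift b) (shift a w).
  by elim: k => //= k IHk; rewrite shiftC IHk.
by elim: m => //= m ->; rewrite step.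
Qed.

Lemma stable_iter_shift n a v : G v -> G (iter n (shift a) v).
Proof.
move=> Gv; elim: n => //= n IHn; apply: subspaceB => //; first exact: GD.
exact: subspaceZ.
Qed.

(** [shift b v - shift a v] is the non-zero multiple [(a - b) *: v], and
    [shift a v] is in [G] by induction on the exponent. *)
Lemma mem_of_shift n a b v : a != b ->
  iter n (shift a) v = 0 -> G (shift b v) -> G v.
Proof.
move=> ab; elim: n v => [|n IHn] v; first by move=> /= ->; case: subG.
rewrite iterSr => av0 Gbv.
have Gav : G (shift a v).
  by apply: IHn => //; rewrite shiftC; apply: (stable_iter_shift 1).
have -> : v = (a - b)^-1 *: (shift b v - shift a v).
  rewrite /shift opprB [_ + (_ - D v)]addrC addrA subrK -scalerBl scalerA.
  by rewrite mulVf ?scale1r ?subr_eq0.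
by apply: subspaceZ => //; apply: subspaceB.
Qed.

Lemma mem_of_iter_shift m n a b v : a != b ->
  iter n (shift a) v = 0 -> G (iter m (shift b) v) -> G v.
Proof.
move=> ab av0; elim: m => //= m IHm Gbv; apply: IHm.
by apply: (mem_of_shift (n := n) ab) Gbv; rewrite iter_shiftC av0 iter_shift0.
Qed.

(** A [D]-stable subspace contains the generalised eigencomponents of its
    elements: applying a power of [shift b] removes the component for [b] and,
    by [mem_of_iter_shift], loses nothing about the other ones. *)
Lemma graded_component (s : seq K) n (y : K -> V) : uniq s ->
  {in s, forall a, iter n (shift a) (y a) = 0} ->
  G (\sum_(a <- s) y a) -> {in s, forall a, G (y a)}.
Proof.
elim: s y => [//|b s IHs] y /andP[b_s s_uniq] y0; rewrite big_cons => Gy.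
have Gs : {in s, forall a, G (y a)}.
  move=> a a_s; have ab : a != b by apply: contraNneq b_s => <-.
  have /(mem_of_iter_shift (m := n) ab) : iter n (shift a) (y a) = 0.
    by rewrite y0 // inE a_s orbT.
  apply; apply: (IHs (fun a => iter n (shift b) (y a))) a_s => // [c c_s|].
    by rewrite iter_shiftC y0 ?iter_shift0 // inE c_s orbT.
  have := stable_iter_shift n b Gy.
  by rewrite iter_shiftD y0 ?mem_head // add0r iter_shift_sum.
move=> a; rewrite inE => /predU1P[->|/Gs //].
rewrite -[y b](addrK (\sum_(a <- s) y a)); apply: subspaceB => //.
by rewrite big_seq; apply: subspace_sum.
Qed.

(** The eigenvalues [mu i] may repeat, so the components with equal eigenvalue
    are grouped before [graded_component] applies; this is possible because the
    coefficient depends on the eigenvalue only. *)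
Lemma graded_multiplier (I : finType) n (mu : I -> K) (y : I -> V)
    (c : K -> K) :
  (forall i, iter n (shift (mu i)) (y i) = 0) ->
  G (\sum_i y i) -> G (\sum_i c (mu i) *: y i).
Proof.
move=> y0; have mu_s i : mu i \in undup (codom mu) by rewrite mem_undup codom_f.
have group (F : I -> V) :
    \sum_i F i = \sum_(a <- undup (codom mu)) \sum_(i | mu i == a) F i.
  rewrite (exchange_big_dep predT) //=; apply: eq_bigr => i _.
  rewrite -big_filter (eq_filter (a2 := pred1 (mu i))) => [|a].
    by rewrite filter_pred1_uniq ?undup_uniq // big_seq1.
  exact: eq_sym.
rewrite !group => Gy.
rewrite (eq_bigr (fun a => c a *: \sum_(i | mu i == a) y i)); last first.
  by move=> a _; rewrite scaler_sumr; apply: eq_bigr => i /eqP->.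
rewrite big_seq; apply: subspace_sum => // a a_s; apply: subspaceZ => //.
apply: (graded_component (n := n) (y := fun a => \sum_(i | mu i == a) y i))
  Gy a a_s; first exact: undup_uniq.
move=> a _; rewrite -big_filter iter_shift_sum big_filter big1 // => i.
by move/eqP<-.
Qed.
End Grading.

(** * Cartan's trace argument *)
Lemma dvdp_prod_roots (F : fieldType) (t s : seq F) : {subset t <= s} ->
  \prod_(a <- t) ('X - a%:P) %| \prod_(a <- s) ('X - a%:P) ^+ size t.
Proof.
elim: t => [|a t IHt] t_s; first by rewrite big_nil dvd1p.
rewrite big_cons /= [X in _ %| X](eq_bigr _ (fun b _ => exprS _ _)).
rewrite big_split /=.
rewrite dvdp_mul ?IHt // => [|b b_t]; last by rewrite t_s // inE b_t orbT.
by rewrite dvdp_XsubCl root_prod_XsubC t_s ?mem_head.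
Qed.

Definition matrix_commutators (F : fieldType) (d : nat) (G : set 'M[F]_d) :
    set 'M[F]_d :=
  [set w | exists y z, [/\ G y, G z & w = y *m z - z *m y]].

Section Cartan.
Variables (E : fieldType) (d : nat).
Notation M := 'M[E]_d.+1.

(** Packaged as a linear map so that the results on generalised eigenvectors
    apply to it. *)
Definition commutator_with (x : M) : M -> M := mulmx x \- mulmxr x.

HB.instance Definition _ x :=
  GRing.Linear.copy (commutator_with x) (mulmx x \- mulmxr x).

(** [ [x, z] - (a - b) z = (x - a) z - z (x - b) ] is a difference of two
    commuting operations, nilpotent on [z] of exponents [p] and [q]. *)
Lemma shift_commutator_with_nilpotent (x z : M) a b p q :
  (x - a%:M) ^+ p * z = 0 -> z * (x - b%:M) ^+ q = 0 ->
  iter (p + q) (shift (commutator_with x) (a - b)) z = 0.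
Proof.
have [n] := ubnP (p + q); elim: n p q z => // n IHn [|p] [|q] z.
- by rewrite expr0 mul1r => _ ->.
- by rewrite expr0 mul1r => _ -> _; rewrite iter_shift0.
- by rewrite expr0 mulr1 => _ _ ->; rewrite iter_shift0.
rewrite ltnS => le_n pz zq; rewrite addSn iterSr.
have -> : shift (commutator_with x) (a - b) z =
    (x - a%:M) * z + - (z * (x - b%:M)).
  rewrite mulrBl mulrBr /shift /commutator_with /= -!mulmxE.
  rewrite mul_scalar_mx mul_mx_scalar scalerBl !opprB.
  by rewrite addrACA [RHS]addrACA; congr (_ + _); rewrite addrC.
have left0 :
    iter (p + q.+1) (shift (commutator_with x) (a - b)) ((x - a%:M) * z) = 0.
  apply: IHn => //; first by rewrite mulrA -exprSr.
  by rewrite -mulrA zq mulr0.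
rewrite iter_shiftD left0 add0r addnS -addSn; apply: IHn.
- by rewrite addSn -addnS.
- by rewrite mulrN mulrA pz mul0r oppr0.
- by rewrite mulNr -mulrA -exprS zq oppr0.
Qed.

(** The heart of Cartan's criterion.  In the proof [f i] is the projection onto
    the generalised eigenspace of [x] for the eigenvalue [l i], and [S] replaces
    each eigenvalue by its image under a functional. *)
Lemma trace_form_nilpotent (G : set M) (x : M) (t : seq E) :
  [pchar E] =i pred0 -> subspace G ->
  (forall y z, G y -> G z -> G (y * z - z * y)) ->
  (forall y z, G y -> G z -> \tr (y * z) = 0) ->
  lspan (matrix_commutators G) x ->
  char_poly x = \prod_(a <- t) ('X - a%:P) ->
  exists k, x ^+ k = 0.
Proof.
move=> E0 subG Gcomm Gtr x_comm x_split.
have Gx : G x.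
  by apply: lspan_min x_comm => // _ [y [z [Gy Gz ->]]]; apply: Gcomm.
pose s := undup t; pose k := size t; have s_uniq : uniq s by apply: undup_uniq.
have [e [sum_e kill_e ortho_e]] := spectral_partition k s_uniq.
have ann p : \prod_(a <- s) ('X - a%:P) ^+ k %| p -> horner_mx x p = 0.
  move=> sp; have /dvdpP[q ->] : char_poly x %| p.
    apply: dvdp_trans sp; rewrite x_split dvdp_prod_roots // => a.
    by rewrite mem_undup.
  by rewrite rmorphM /= Cayley_Hamilton mulr0.
pose m := size s; pose l (i : 'I_m) := s`_i.
pose f (i : 'I_m) := horner_mx x (e (l i)).
have l_s i : l i \in s by rewrite mem_nth.
have l_inj : injective l.
  by move=> i j /eqP; rewrite nth_uniq // => /eqP /val_inj.
have sum_f : \sum_i f i = 1.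
  move: (ann _ sum_e); rewrite rmorphB rmorph1 rmorph_sum /= => /eqP.
  by rewrite subr_eq0 => /eqP->; rewrite (big_nth 0) big_mkord.
have hX a : horner_mx x ('X - a%:P) = x - a%:M.
  by rewrite rmorphB /= horner_mx_X horner_mx_C.
have kill_f i : f i * (x - (l i)%:M) ^+ k = 0.
  by rewrite -hX -rmorphXn -rmorphM /= ann // kill_e.
have kill_f' i : (x - (l i)%:M) ^+ k * f i = 0.
  by rewrite -hX -rmorphXn -rmorphM /= mulrC ann // kill_e.
have ff i : f i * f i = f i.
  rewrite -[RHS]mulr1 -sum_f mulr_sumr (bigD1 i) //= big1 ?addr0 // => j ji.
  by rewrite -rmorphM /= ann // ortho_e // inj_eq // eq_sym.
(* On the image of [f i], [x] is [l i] plus a nilpotent map. *)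
have trace_fx i : \tr (f i * x) = l i *+ \rank (f i).
  have : \tr (f i * (x - (l i)%:M)) = 0.
    apply: (@mxtrace_nilpotent _ _ _ k.+1).
    rewrite -hX -rmorphM -rmorphXn /= ann // exprMn exprSr mulrAC exprS mulrA.
    rewrite -[_ * _ * e _]mulrA [_ ^+ k * e _]mulrC; apply: dvdp_mull.
    exact: kill_e.
  rewrite mulrBr linearB /= -mulmxE mul_mx_scalar mxtraceZ.
  rewrite (mxtrace_idempotent (ff i)).
  by move/eqP; rewrite subr_eq0 => /eqP->; rewrite mulr_natr.
have nil_l : forall i, (0 < \rank (f i))%N -> l i = 0.
  apply: (rational_functional E0) => c c_add.
  pose S := \sum_i c i *: f i.
  have S_comm y : G y -> G (S * y - y * S).
    move=> Gy.
    (* The condition on [c] says that [c i - c j] depends only on the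
       eigenvalue [l i - l j] of [ad x]. *)
    have c_diff : exists h, forall i j, h (l i - l j) = c i - c j.
      exists (fun u => if [pick p | l p.1 - l p.2 == u] is Some p
                       then c p.1 - c p.2 else 0) => i j.
      by case: pickP => [p /eqP/c_add // | /(_ (i, j))]; rewrite eqxx.
    have [h hE] := c_diff.
    have yE : \sum_p f p.1 * y * f p.2 = y.
      rewrite -[RHS]mul1r -[RHS]mulr1 -sum_f.
      rewrite -(pair_bigA _ (fun i j => f i * y * f j)) /=.
      by rewrite !mulr_suml; apply: eq_bigr => i _; rewrite mulr_sumr.
    have -> : S * y - y * S = \sum_p h (l p.1 - l p.2) *: (f p.1 * y * f p.2).
      transitivity (\sum_p (c p.1 *: (f p.1 * y * f p.2) -
                            c p.2 *: (f p.1 * y * f p.2))); last first.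
        by apply: eq_bigr => p _; rewrite hE scalerBl.
      rewrite sumrB -(pair_bigA _ (fun i j => c i *: (f i * y * f j))) /=.
      rewrite -(pair_bigA _ (fun i j => c j *: (f i * y * f j))) /=.
      congr (_ - _).
        rewrite mulr_suml; apply: eq_bigr => i _.
        by rewrite -scaler_sumr -mulr_sumr sum_f mulr1 scalerAl.
      rewrite exchange_big mulr_sumr; apply: eq_bigr => i _ /=.
      by rewrite -scaler_sumr -!mulr_suml sum_f mul1r scalerAr.
    apply: (graded_multiplier (D := commutator_with x) subG _ (n := k + k)).
    - by move=> v Gv; apply: Gcomm.
    - move=> p; apply: shift_commutator_with_nilpotent.
        by rewrite !mulrA kill_f' !mul0r.
      by rewrite -!mulrA kill_f !mulr0.
    - by rewrite yE.
  have S_ortho : forall w, lspan (matrix_commutators G) w -> \tr (S * w) = 0.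
    apply: lspan_min; first split=> /= [|a u v Su Sv].
    - by rewrite mulr0 mxtrace0.
    - by rewrite mulrDr mxtraceD -scalerAr mxtraceZ Su Sv mulr0 addr0.
    move=> _ [y [z [Gy Gz ->]]] /=; rewrite -[RHS](Gtr _ _ (S_comm y Gy) Gz).
    rewrite mulrBr mulrBl !linearB /= !mulrA; congr (_ - _).
    by rewrite -!mulmxE mxtrace_mulC mulmxA.
  rewrite -[RHS](S_ortho x x_comm) mulr_suml linear_sum; apply: eq_bigr => i _.
  by rewrite -scalerAl -trace_fx; apply/esym/mxtraceZ.
exists k; rewrite -[LHS]mul1r -sum_f mulr_suml big1 // => i _.
have [f0|] := posnP (\rank (f i)).
  by move/eqP: f0; rewrite mxrank_eq0 => /eqP->; rewrite mul0r.
by move/nil_l => li; rewrite -[RHS](kill_f i) li raddf0 subr0.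
Qed.
End Cartan.

(** Nilpotency, brackets and the trace form are compatible with extension of
    scalars, so the eigenvalues of [x] may be assumed to lie in the field. *)
Lemma traceless_perfect_nilpotent (K : fieldType) (d : nat) (G : set 'M[K]_d.+1)
    (x : 'M[K]_d.+1) :
  [pchar K] =i pred0 -> subspace G ->
  (forall y z, G y -> G z -> G (y * z - z * y)) ->
  (forall y z, G y -> G z -> \tr (y * z) = 0) ->
  lspan (matrix_commutators G) x ->
  exists k, x ^+ k = 0.
Proof.
move=> K0 subG Gcomm Gtr x_comm.
have [E [f [t x_split]]] := splitting_extension (char_poly_monic x).
pose fG := lspan [set map_mx f y | y in G].
have fG_comm y z : fG y -> fG z -> fG (y * z - z * y).
  apply: (@lspan_bilinear _ _ _ _ (fun y z => y * z - z * y)).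
  - move=> z' a u v; rewrite mulrDl mulrDr -scalerAl -scalerAr scalerBr.
    by rewrite opprD addrACA.
  - move=> z' a u v; rewrite mulrDl mulrDr -scalerAl -scalerAr scalerBr.
    by rewrite opprD addrACA.
  - exact: lspan_subspace.
  move=> _ _ [u Gu <-] [v Gv <-]; apply: sub_lspan; exists (u * v - v * u).
    exact: Gcomm.
  by rewrite map_mxB -!mulmxE !map_mxM.
have fG_tr y z : fG y -> fG z -> \tr (y * z) = 0.
  apply: (@lspan_bilinear _ _ _ E^o (fun y z => \tr (y * z)) _ _ [set 0]).
  - by move=> v a u u'; rewrite mulrDl -scalerAl mxtraceD mxtraceZ.
  - by move=> v a u u'; rewrite mulrDr -scalerAr mxtraceD mxtraceZ.
  - by split=> //= a u v -> ->; rewrite scaler0 addr0.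
  move=> _ _ [u Gu <-] [v Gv <-] /=.
  by rewrite -mulmxE -map_mxM trace_map_mx mulmxE Gtr ?rmorph0.
have f_lin : subspace [set w | lspan (matrix_commutators fG) (map_mx f w)].
  have [C0 CZ] := lspan_subspace (matrix_commutators fG).
  split=> [|a u v Cu Cv] /=; first by rewrite map_mx0.
  by rewrite map_mxD map_mxZ; apply: CZ.
have [|||k xk] := trace_form_nilpotent (x := map_mx f x) (t := t) _
  (lspan_subspace _) fG_comm fG_tr.
- by move=> p; rewrite (fmorph_pchar f).
- apply: (lspan_min f_lin) x_comm => _ [y [z [Gy Gz ->]]] /=.
  apply: sub_lspan; exists (map_mx f y), (map_mx f z).
  split; [by apply: sub_lspan; exists y | by apply: sub_lspan; exists z |].
  by rewrite map_mxB !map_mxM.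
- by rewrite -map_char_poly x_split.
exists k; apply: (map_mx_inj (f := f)); rewrite map_mx0 -xk.
by rewrite -[RHS]rmorphXn.
Qed.

Lemma traceless_perfect_iter0 (K : fieldType) (d : nat) (G : set 'M[K]_d)
    (x : 'M[K]_d) :
  [pchar K] =i pred0 -> subspace G ->
  (forall y z, G y -> G z -> G (y *m z - z *m y)) ->
  (forall y z, G y -> G z -> \tr (y *m z) = 0) ->
  lspan (matrix_commutators G) x ->
  exists k, forall u : 'rV[K]_d, iter k (mulmx^~ x) u = 0.
Proof.
case: d G x => [|d] G x K0 subG Gcomm Gtr x_comm.
  by exists 0%N => u; apply: thinmx0.
have [k xk] := traceless_perfect_nilpotent K0 subG Gcomm Gtr x_comm.
exists k => u; rewrite -[RHS](mulmx0 _ u) -xk; elim: k {xk} => [|k IHk] /=.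
  by rewrite expr0 mulmx1.
by rewrite IHk exprSr -mulmxE mulmxA.
Qed.

(** * Finite-dimensional subspaces *)

(** The relations between the generators form a row space [W]; restricting the
    linear combination map to a complement of [W] makes it injective. *)
Lemma findim_coordinates (K : fieldType) (V : lmodType K) (A : set V) :
  findim A -> exists d (phi : {linear 'rV[K]_d -> V}),
    injective phi /\ A = [set phi u | u in setT].
Proof.
move=> [s ->]; pose m := size s.
pose psi (r : 'rV[K]_m) : V := \sum_i r 0 i *: s`_i.
have psi_lin : linear psi.
  move=> a u v; rewrite /psi scaler_sumr -big_split; apply: eq_bigr => i _.
  by rewrite !mxE scalerDl scalerA.
have psi_span : lspan [set` s] = [set psi r | r in setT].
  apply/seteqP; split.
    apply: lspan_min; first exact: subspace_image.
    move=> x /= xs; have lt_xs : (index x s < m)%N by rewrite index_mem.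
    exists (delta_mx 0 (Ordinal lt_xs)) => //.
    rewrite /psi (bigD1 (Ordinal lt_xs)) //=.
    rewrite mxE !eqxx scale1r nth_index // big1 ?addr0 // => i /negPf ni.
    by rewrite mxE ni andbF scale0r.
  move=> _ [r _ <-]; rewrite /psi; apply: (subspace_sum _ (lspan_subspace _)).
  move=> i _; apply: (subspaceZ _ (lspan_subspace _)).
  by apply: sub_lspan => /=; rewrite mem_nth.
have ker_sub : subspace [set r | psi r = 0].
  exact: (subspace_preimage psi_lin subspace0).
have [W kerW] := subspace_rowspace ker_sub.
pose B := row_base W^C%MS.
pose phi0 (u : 'rV[K]_(\rank W^C)) : V := psi (u *m B).
have phi_lin : linear phi0.
  by move=> a u v; rewrite /phi0 mulmxDl -scalemxAl psi_lin.
pose phiL := GRing.isLinear.Build K _ V *:%R phi0 phi_lin.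
pose phi : {linear 'rV[K]_(\rank W^C) -> V} := HB.pack phi0 phiL.
exists _, phi; split.
  apply: raddf_inj => u /kerW uW; apply/eqP.
  rewrite -(mulmx_free_eq0 _ (row_base_free W^C%MS)) -submx0.
  rewrite -(capmx_compl W) sub_capmx uW.
  by apply: submx_trans (submxMl _ _) _; rewrite eq_row_base.
rewrite psi_span; apply/seteqP; split=> _ [r _ <-]; last by exists (r *m B).
have : (r <= W + B)%MS.
  rewrite (adds_eqmx (eqmx_refl W) (eq_row_base _)).
  by rewrite submx_full ?addsmx_compl_full.
case/sub_addsmxP => -[u v] /= ->; exists v => //.
rewrite /= /phi0 -[u *m W]scale1r psi_lin.
by rewrite (proj2 (kerW _) (submxMl u W)) scaler0 add0r.
Qed.

Lemma findim_range (K : fieldType) (V : lmodType K) d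
    (phi : {linear 'rV[K]_d -> V}) :
  findim [set phi u | u in setT].
Proof.
exists [seq phi (delta_mx 0 i) | i <- enum 'I_d].
apply/seteqP; split.
  move=> _ [u _ <-]; rewrite (row_sum_delta u) linear_sum.
  apply: (subspace_sum _ (lspan_subspace _)) => i _.
  rewrite linearZ; apply: (subspaceZ _ (lspan_subspace _)).
  by apply: sub_lspan => /=; apply/mapP; exists i; rewrite ?mem_enum.
apply: lspan_min; first exact: (subspace_image (linearP phi)).
by move=> x /= /mapP[i _ ->]; exists (delta_mx 0 i).
Qed.

Lemma findim_subspace (K : fieldType) (V : lmodType K) (A B : set V) :
  findim A -> subspace B -> B `<=` A -> findim B.
Proof.
move=> /findim_coordinates[d [phi [phi_inj ->]]] sB BA.
have [W WB] : exists W : 'M[K]_d, forall r, B (phi r) <-> (r <= W)%MS.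
  by apply: subspace_rowspace; apply: subspace_preimage => //; apply: linearP.
have -> : B = [set (phi \o mulmxr W) u | u in setT].
  apply/seteqP; split=> [x Bx|_ [u _ <-]]; last by apply/WB; apply: submxMl.
  have [r _ rx] := BA x Bx; move: Bx; rewrite -rx => /WB/submxP[u ->].
  by exists u.
exact: findim_range.
Qed.

(** Strict monotonicity of the dimension is what produces maximal and minimal
    members of families of subspaces. *)
Lemma findim_dimension (K : fieldType) (V : lmodType K) (A : set V) :
  findim A -> exists (dim : set V -> nat) (d : nat),
    (forall B, (dim B <= d)%N) /\
    (forall B C, subspace B -> subspace C -> C `<=` A -> B `<` C ->
      (dim B < dim C)%N).
Proof.
move=> /findim_coordinates[d [phi [phi_inj ->]]].
have /choice[W WB] : forall B : set V, exists W : 'M[K]_d,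
    subspace B -> forall r, B (phi r) <-> (r <= W)%MS.
  move=> B; have [sB|nB] := pselect (subspace B); last by exists 0.
  have [W WB] : exists W : 'M[K]_d, forall r, B (phi r) <-> (r <= W)%MS.
    by apply: subspace_rowspace; apply: subspace_preimage => //; apply: linearP.
  by exists W.
exists (fun B => \rank (W B)), d; split=> [B|B C sB sC CA [BC CB]].
  exact: rank_leq_row.
apply: rank_ltmx; rewrite ltmxE; apply/andP; split.
  apply/row_subP => i; apply/WB => //; apply: BC.
  by apply/WB => //; apply: row_sub.
apply/negP => CB'; apply: CB => x Cx; have [r _ rx] := CA x Cx.
move: Cx; rewrite -rx => /WB - /(_ sC) rC; apply/WB => //.
exact: submx_trans CB'.
Qed.

Lemma findim_maximal (K : fieldType) (V : lmodType K) (A : set V)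
    (P : set (set V)) :
  findim A -> (forall B, P B -> subspace B /\ B `<=` A) -> P !=set0 ->
  exists2 B, P B & forall C, P C -> B `<=` C -> C `<=` B.
Proof.
move=> /findim_dimension[dim [d [le_d lt_dim]]] PA [B0 PB0].
pose Q k := `[< exists2 B, P B & dim B = k >].
have exQ : exists k, Q k by exists (dim B0); apply/asboolP; exists B0.
have leQ k : Q k -> (k <= d)%N by move=> /asboolP[B _ <-].
case: (ex_maxnP exQ leQ) => k /asboolP[B PB dimB] max_k.
exists B => // C PC BC; apply: contrapT => nCB.
have : (dim C <= k)%N by apply: max_k; apply/asboolP; exists C.
rewrite -dimB leqNgt lt_dim //; by case: (PA _ PB); case: (PA _ PC).
Qed.

Lemma findim_minimal (K : fieldType) (V : lmodType K) (A : set V)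
    (P : set (set V)) :
  findim A -> (forall B, P B -> subspace B /\ B `<=` A) -> P !=set0 ->
  exists2 B, P B & forall C, P C -> C `<=` B -> B `<=` C.
Proof.
move=> /findim_dimension[dim [d [_ lt_dim]]] PA [B0 PB0].
pose Q k := `[< exists2 B, P B & dim B = k >].
have exQ : exists k, Q k by exists (dim B0); apply/asboolP; exists B0.
case: (ex_minnP exQ) => k /asboolP[B PB dimB] min_k.
exists B => // C PC CB; apply: contrapT => nBC.
have : (k <= dim C)%N by apply: min_k; apply/asboolP; exists C.
rewrite -dimB leqNgt lt_dim //; by case: (PA _ PB); case: (PA _ PC).
Qed.

(** * Lie brackets *)
Section LieBasics.
Context {K : fieldType} {L : lieAlgType K}.
Implicit Types (x y z : L) (A B I : set L).

Lemma lieDl x y z : ⟦x + y, z⟧ = ⟦x, z⟧ + ⟦y, z⟧.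
Proof. by have := lie_linearl z 1 x y; rewrite !scale1r. Qed.

Lemma lieDr x y z : ⟦x, y + z⟧ = ⟦x, y⟧ + ⟦x, z⟧.
Proof. by have := lie_linearr x 1 y z; rewrite !scale1r. Qed.

Lemma lie0l x : ⟦0, x⟧ = 0.
Proof. exact: (linear_at0 (lie_linearl x)). Qed.

Lemma lie0r x : ⟦x, 0⟧ = 0.
Proof. exact: (linear_at0 (lie_linearr x)). Qed.

Lemma lieZl a x y : ⟦a *: x, y⟧ = a *: ⟦x, y⟧.
Proof. by have := lie_linearl y a x 0; rewrite lie0l !addr0. Qed.

Lemma lieZr a x y : ⟦x, a *: y⟧ = a *: ⟦x, y⟧.
Proof. by have := lie_linearr x a y 0; rewrite lie0r !addr0. Qed.

Lemma lieC x y : ⟦x, y⟧ = - ⟦y, x⟧.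
Proof.
have := liexx (x + y); rewrite lieDl !lieDr !liexx add0r addr0.
by move/eqP; rewrite addr_eq0 => /eqP.
Qed.

Lemma lieNr x y : ⟦x, - y⟧ = - ⟦x, y⟧.
Proof. by rewrite -scaleN1r lieZr scaleN1r. Qed.

Lemma lieNl x y : ⟦- x, y⟧ = - ⟦x, y⟧.
Proof. by rewrite -scaleN1r lieZl scaleN1r. Qed.


(** Jacobi's identity, as the statement that [ad z] is a derivation. *)
Lemma lie_leibniz x y z : ⟦⟦x, y⟧, z⟧ = ⟦⟦x, z⟧, y⟧ + ⟦x, ⟦y, z⟧⟧.
Proof.
have := lie_jacobi x y z; rewrite [⟦z, ⟦x, y⟧⟧]lieC [⟦z, x⟧]lieC lieNr.
rewrite [⟦y, ⟦x, z⟧⟧]lieC opprK.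
by move/eqP; rewrite subr_eq0 => /eqP <-; apply: addrC.
Qed.

Lemma lie_commutator_subspace A B : subspace (lie_commutator A B).
Proof. exact: lspan_subspace. Qed.

Lemma mem_lie_commutator A B x y : A x -> B y -> lie_commutator A B ⟦x, y⟧.
Proof. by move=> Ax By; apply: sub_lspan; exists x, y. Qed.

Lemma lie_commutator_min A B C : subspace C ->
  (forall x y, A x -> B y -> C ⟦x, y⟧) -> lie_commutator A B `<=` C.
Proof.
by move=> sC ABC; apply: lspan_min => // _ [x [y [Ax By ->]]]; apply: ABC.
Qed.

Lemma ideal_lie_commutator I : ideal I -> ideal (lie_commutator I I).
Proof.
move=> [sI IL]; split=> [|x y Ix]; first exact: lie_commutator_subspace.
move: x Ix; apply: lie_commutator_min => [|x z Ix Iz].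
  apply: (subspace_preimage (lie_linearl y)); exact: lie_commutator_subspace.
rewrite /= lie_leibniz; apply: (subspaceD (lie_commutator_subspace I I)).
  by apply: mem_lie_commutator => //; apply: IL.
by apply: mem_lie_commutator => //; apply: IL.
Qed.

Lemma ideal_subalgebra I : ideal I -> subalgebra I.
Proof. by move=> [sI IL]; split=> // x y Ix _; apply: IL. Qed.

(** * Engel's theorem *)

(** The span of the iterated brackets of an element of [M] with [k] elements of
    [h]; the lower central series when [h] is [M]. *)
Definition descending (M h : set L) (k : nat) : set L :=
  iter k (fun B => lie_commutator B h) M.

Section Engel.
Variable M : set L.
Hypotheses (M_alg : subalgebra M).

Lemma descending_subspace h k : subspace (descending M h k).
Proof. by case: k => [|k]; [case: M_alg | apply: lie_commutator_subspace]. Qed.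

Lemma descending_decr h k :
  h `<=` M -> descending M h k.+1 `<=` descending M h k.
Proof.
move=> hM; elim: k => [|k IHk].
  apply: lie_commutator_min; first by case: M_alg.
  by move=> x y Mx /hM; apply: M_alg.2.
apply: lie_commutator_min => [|x y Fx hy]; first exact: descending_subspace.
by apply: mem_lie_commutator => //; apply: IHk.
Qed.

Lemma descending_sub h k : h `<=` M -> descending M h k `<=` M.
Proof. by move=> hM; elim: k => // k IHk x /(descending_decr hM)/IHk. Qed.

Lemma descending_normalised h x k :
  h `<=` M -> M x -> (forall a, h a -> h ⟦a, x⟧) ->
  forall y, descending M h k y -> descending M h k ⟦y, x⟧.
Proof.
move=> hM Mx hx; elim: k => [|k IHk] y; first by move=> My; apply: M_alg.2.
move: y; apply: lie_commutator_min => [|y a Fy ha].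
  apply: (subspace_preimage (lie_linearl x)); exact: descending_subspace.
rewrite lie_leibniz; apply: (subspaceD (descending_subspace h k.+1)).
  by apply: mem_lie_commutator => //; apply: IHk.
by apply: mem_lie_commutator => //; apply: hx.
Qed.

(** If every element outside [h] could be bracketed with [h] to stay outside
    [h], this could be repeated [N] times, while the result has to be [0]. *)
Lemma normaliser_grows h N : subspace h -> h `<=` M ->
  descending M h N `<=` [set 0] -> ~ (M `<=` h) ->
  exists x, [/\ M x, ~ h x & forall a, h a -> h ⟦a, x⟧].
Proof.
move=> sh hM hN Mh; apply: contrapT => none.
have step x : M x -> ~ h x -> exists2 a, h a & ~ h ⟦x, a⟧.
  move=> Mx nhx; apply: contrapT => no; apply: none; exists x; split=> // a ha.
  apply: contrapT => nhax; apply: no; exists a => // hxa; apply: nhax.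
  by rewrite lieC; apply: subspaceN.
have [z Mz nhz] : exists2 z, descending M h N z & ~ h z.
  elim: N {hN} => [|N [z Fz nhz]].
    apply: contrapT => no; apply: Mh => z Mz; apply: contrapT => nhz.
    by apply: no; exists z.
  have [a ha nhza] := step z (descending_sub hM Fz) nhz.
  by exists ⟦z, a⟧ => //; apply: mem_lie_commutator.
by apply: nhz; rewrite (hN z Mz); apply: sh.1.
Qed.

(** The filtration [descending M h] is stable under [ad x], and [ad a] with [a]
    in [h] moves it one step down.  So modulo the next step [h + K x] acts
    through powers of [ad x] only, and [m] brackets go down one step. *)
Lemma nilpotent_extension h x N m : subspace h -> h `<=` M -> M x ->
  (forall a, h a -> h ⟦a, x⟧) -> descending M h N `<=` [set 0] ->
  (forall u, M u -> iter m (ad x) u = 0) ->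
  exists k,
    descending M [set y | exists2 a, h a & exists c, y = a + c *: x] k
      `<=` [set 0].
Proof.
move=> sh hM Mx hx hN xm; set h' := [set y | _].
have F_step k : descending M h k.+1 `<=` descending M h k.
  exact: descending_decr.
have F_x k y : descending M h k y -> descending M h k ⟦y, x⟧.
  exact: descending_normalised.
have F_sub k := descending_subspace h k.
suff down k : exists j, descending M h' j `<=` descending M h k.
  by have [j jN] := down N; exists j => y /jN/hN.
elim: k => [|k [j jk]].
  by exists 0%N.
exists (m + j)%N.
have iter_ad_lin i : linear (iter i (ad x)).
  by elim: i => [|i IHi] a u v //; rewrite !iterS IHi /ad lie_linearl.
(* After [i] brackets, an element of the [k]-th step is, modulo the next step,
   the image of an element of the [k]-th step under [ad x ^+ i]. *)
have coset i : descending M h' (i + j) `<=`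
    [set z | exists2 u, descending M h k u &
                        descending M h k.+1 (z - iter i (ad x) u)].
  elim: i => [|i IHi].
    move=> z /jk Fz; exists z => //=; rewrite subrr.
    exact: (F_sub k.+1).1.
  rewrite addSn; apply: lie_commutator_min.
    split=> [|a u v [u' Fu' uu'] [v' Fv' vv']].
      exists 0; first exact: (F_sub k).1.
      rewrite (linear_at0 (iter_ad_lin _)) subr0; exact: (F_sub k.+1).1.
    exists (a *: u' + v'); first by apply: (F_sub k).2.
    rewrite iter_ad_lin opprD addrACA -scalerBr.
    exact: (F_sub k.+1).2.
  move=> z _ /IHi[u Fu zu] [a ha [c ->]].
  have Fiu : descending M h k (iter i (ad x) u).
    by elim: i {IHi zu} => //= i; apply: F_x.
  have Fz : descending M h k z.
    rewrite -[z](subrK (iter i (ad x) u)).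
    by apply: (subspaceD (F_sub k)) => //; apply: F_step.
  exists (c *: u); first exact: subspaceZ.
  have -> : iter i.+1 (ad x) (c *: u) = c *: ⟦iter i (ad x) u, x⟧.
    have := iter_ad_lin i.+1 c u 0.
    by rewrite (linear_at0 (iter_ad_lin _)) !addr0.
  rewrite lieDr lieZr -addrA -scalerBr -lieNl -lieDl.
  apply: (subspaceD (F_sub k.+1)); first exact: mem_lie_commutator.
  by apply: (subspaceZ _ (F_sub k.+1)); apply: F_x.
move=> z /coset[u Fu]; rewrite xm ?subr0 //.
exact: (descending_sub hM) Fu.
Qed.

(** A maximal subspace [h] closed under brackets and acting nilpotently on [M]
    is all of [M]: otherwise it could be enlarged by an element normalising it.
    *)
Lemma engel : findim M ->
  (forall x, M x -> exists m, forall u, M u -> iter m (ad x) u = 0) ->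
  exists k, descending M M k `<=` [set 0].
Proof.
move=> M_fin M_nil.
pose P := [set h : set L | [/\ subspace h, h `<=` M,
  forall x y, h x -> h y -> h ⟦x, y⟧ &
  exists k, descending M h k `<=` [set 0]]].
have [||h [sh hM h_alg [N hN]] h_max] := @findim_maximal _ _ M P M_fin.
- by move=> B [].
- exists [set 0]; split.
  + exact: subspace0.
  + by move=> _ ->; case: M_alg.1.
  + by move=> _ _ -> ->; rewrite /= lie0l.
  exists 1; apply: lie_commutator_min => [|x _ _ ->]; last by rewrite /= lie0r.
  exact: subspace0.
suff Mh : M `<=` h.
  have hE : h = M by apply/seteqP.
  by exists N; move: hN; rewrite hE.
apply: contrapT => nMh.
have [x [Mx nhx hx]] := normaliser_grows sh hM hN nMh.
have [m xm] := M_nil x Mx.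
apply: nhx; apply: (h_max [set y | exists2 a, h a & exists c, y = a + c *: x]).
- split.
  + split; first by exists 0; [apply: sh.1 | exists 0; rewrite scale0r addr0].
    move=> c _ _ [a ha [e ->]] [a' ha' [e' ->]].
    exists (c *: a + a'); first exact: sh.2.
    by exists (c * e + e'); rewrite scalerDr scalerA scalerDl addrACA.
  + move=> _ [a ha [c ->]]; apply: subspaceD; [exact: M_alg.1|exact: hM|].
    by apply: subspaceZ => //; apply: M_alg.1.
  + move=> _ _ [a ha [c ->]] [a' ha' [c' ->]].
    exists ⟦a + c *: x, a' + c' *: x⟧; last first.
      by exists 0; rewrite scale0r addr0.
    rewrite lieDl !lieDr !lieZl !lieZr liexx !scaler0 addr0.
    apply: subspaceD => //; last first.
      by rewrite lieC; apply: subspaceZ => //; apply: subspaceN => //;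
         apply: hx.
    apply: subspaceD => //; first exact: h_alg.
    by apply: subspaceZ => //; apply: hx.
  exact: nilpotent_extension hN xm.
- by move=> a ha; exists a => //; exists 0; rewrite scale0r addr0.
by exists 0; [apply: sh.1 | exists 1; rewrite scale1r add0r].
Qed.

End Engel.
End LieBasics.

(** * Minimal ideals and the Killing form *)
Definition centralises (K : fieldType) (L : lieAlgType K) (M : set L) (x : L) :=
  forall u, M u -> ⟦u, x⟧ = 0.

Definition minimal_ideal (K : fieldType) (L : lieAlgType K) (M : set L) :=
  [/\ ideal M, M <> [set 0], findim M &
      forall I, ideal I -> I `<=` M -> I = [set 0] \/ I = M].

Section MinimalIdeals.
Context {K : fieldType} {L : lieAlgType K}.
Implicit Types (x y z : L) (A B I M : set L).

Lemma centralisesZD M a x y : centralises M x -> centralises M y ->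
  centralises M (a *: x + y).
Proof. by move=> cx cy u Mu; rewrite lieDr lieZr cx // cy // scaler0 addr0. Qed.

Lemma centralises_lie M x y :
  ideal M -> centralises M x -> centralises M ⟦x, y⟧.
Proof.
move=> [_ ML] cx u Mu; have := lie_leibniz u x y.
by rewrite cx // cx ?lie0l; [rewrite add0r => <- | apply: ML].
Qed.

Lemma exists_minimal_ideal V : ideal V -> findim V -> V <> [set 0] ->
  exists2 M : set L, minimal_ideal M & M `<=` V.
Proof.
move=> V_ideal V_fin V0.
pose P := [set I : set L | [/\ ideal I, I `<=` V & I <> [set 0]]].
have [|| M [M_ideal MV M0] min_M] := @findim_minimal _ _ V P V_fin.
- by move=> I [[]].
- by exists V; split.
exists M => //; split=> // [|I I_ideal IM].
  by apply: findim_subspace V_fin _ MV; case: M_ideal.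
have [->|I0] := pselect (I = [set 0]); [by left | right].
apply/seteqP; split=> //; apply: min_M => //; split=> //.
exact: subset_trans MV.
Qed.

Hypothesis (L_semisimple : semisimple L).

(** An abelian ideal is solvable, hence locally solvable. *)
Lemma abelian_ideal0 I :
  ideal I -> (forall x y, I x -> I y -> ⟦x, y⟧ = 0) -> I = [set 0].
Proof.
move=> I_ideal I_ab; apply: L_semisimple => // X _ XI; exists I; split=> //.
  exact: ideal_subalgebra.
exists 1%N; apply/seteqP; split; last first.
  by move=> _ ->; apply: (lie_commutator_subspace _ _).1.
by apply: lie_commutator_min; [apply: subspace0 | apply: I_ab].
Qed.

Lemma minimal_ideal_perfect M : minimal_ideal M -> lie_commutator M M = M.
Proof.
move=> [M_ideal M0 _ min_M].
have [||comm0|//] := min_M (lie_commutator M M).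
- exact: ideal_lie_commutator.
- apply: lie_commutator_min => [|x y Mx _]; first by case: M_ideal.
  exact: M_ideal.2.
case: M0; apply: abelian_ideal0 => // x y Mx My.
by have := mem_lie_commutator Mx My; rewrite comm0.
Qed.

Lemma centralising_member0 M x : ideal M -> M x -> centralises M x -> x = 0.
Proof.
move=> M_ideal Mx cx; have [sM ML] := M_ideal.
suff center0 : [set x | M x /\ centralises M x] = [set 0].
  by have : [set x | M x /\ centralises M x] x by []; rewrite center0.
apply: abelian_ideal0 => [|y z [My _] [_ cz]]; last exact: cz.
split=> [|y z [My cy]]; last by split; [apply: ML | apply: centralises_lie].
split=> [|a y z [My cy] [Mz cz]].
  by split; [apply: sM.1 | move=> u; rewrite lie0r].
by split; [apply: sM.2 | apply: centralisesZD].
Qed.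

(** [phi] gives coordinates on the ideal [M], and [A x] is the matrix of
    [ad x] on [M] for an arbitrary [x] of [L], in the row vector convention.
    All identities about [A] are read off through the injectivity of [phi]. *)
Section Adjoint.
Variables (M : set L) (d : nat) (phi : {linear 'rV[K]_d -> L}).
Variable A : L -> 'M[K]_d.
Hypotheses (M_ideal : ideal M) (phi_inj : injective phi).
Hypothesis M_phi : M = [set phi u | u in setT].
Hypothesis (A_phi : forall x u, phi (u *m A x) = ⟦phi u, x⟧).

Let M_of u : M (phi u). Proof. by rewrite M_phi; exists u. Qed.
Let of_M x : M x -> exists u, x = phi u.
Proof. by rewrite M_phi => -[u _ <-]; exists u. Qed.

Let mx_ext (X Y : 'M[K]_d) : (forall u : 'rV_d, u *m X = u *m Y) -> X = Y.
Proof. by move=> XY; apply/row_matrixP => i; rewrite !rowE. Qed.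

Lemma adjoint_linear : linear A.
Proof.
move=> a x y; apply: mx_ext => u; apply: phi_inj.
by rewrite mulmxDr -scalemxAr linearP !A_phi lieDr lieZr.
Qed.

Lemma adjoint_lie x y : A ⟦x, y⟧ = A x *m A y - A y *m A x.
Proof.
apply: mx_ext => u; apply: phi_inj.
rewrite mulmxBr linearB /= !mulmxA !A_phi (lie_leibniz (phi u) x y).
by rewrite addrAC subrr add0r.
Qed.

Lemma adjoint_iter x u k :
  phi (iter k (mulmx^~ (A x)) u) = iter k (ad x) (phi u).
Proof. by elim: k => //= k <-; rewrite A_phi. Qed.

(** The form is defined, and invariant, on the whole of [L]; this makes its
    radical on [M] an ideal of [L] and not just of [M]. *)
Definition killing x y := \tr (A x *m A y).

Lemma killingZDl a x y z :
  killing (a *: x + y) z = a * killing x z + killing y z.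
Proof.
by rewrite /killing adjoint_linear mulmxDl -scalemxAl mxtraceD mxtraceZ.
Qed.

Lemma killingC x y : killing x y = killing y x.
Proof. exact: mxtrace_mulC. Qed.

Lemma killing_invariant x y z : killing ⟦x, y⟧ z = killing x ⟦y, z⟧.
Proof.
rewrite /killing !adjoint_lie mulmxBl mulmxBr !linearB /= !mulmxA.
by rewrite -[A y *m A x *m A z]mulmxA [\tr (A y *m _)]mxtrace_mulC.
Qed.

Lemma killing_linear y : linear (killing^~ y : L -> K^o).
Proof. by move=> a u v; apply: killingZDl. Qed.

Definition killing_radical := [set x | M x /\ forall y, M y -> killing x y = 0].

Lemma killing_radical_ideal : ideal killing_radical.
Proof.
have [[M0 MZ] ML] := M_ideal; split=> [|x y [Mx x0]].
  split=> [|a x y [Mx x0] [My y0]].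
    by split=> // y _; apply: (linear_at0 (killing_linear y)).
  by split=> [|z Mz]; [apply: MZ | rewrite killingZDl x0 // y0 // mulr0 addr0].
split=> [|z Mz]; first exact: ML.
rewrite killing_invariant x0 // lieC.
by apply: subspaceN; [case: M_ideal | apply: ML].
Qed.

Hypothesis K0 : [pchar K] =i pred0.

(** The only alternative is that the form vanishes on [M]; then Cartan's
    argument and Engel's theorem contradict the perfectness of [M]. *)
Lemma killing_nondegenerate : minimal_ideal M -> killing_radical = [set 0].
Proof.
move=> M_min; have [_ M0 M_fin min_M] := M_min.
have [x [] //|//|radM] := min_M _ killing_radical_ideal.
case: M0; have [k] : exists k, descending M M k `<=` [set 0].
  apply: engel => [||x Mx]; [exact: ideal_subalgebra | by [] |].
  suff [k kill] : exists k, forall u : 'rV_d, iter k (mulmx^~ (A x)) u = 0.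
    by exists k => _ /of_M[u ->]; rewrite -adjoint_iter kill linear0.
  have sub_fam : subspace [set A y | y in M].
    by apply: (subspace_image adjoint_linear); case: M_ideal.
  apply: (traceless_perfect_iter0 K0 sub_fam).
  - move=> _ _ [y My <-] [z Mz <-]; exists ⟦y, z⟧; first exact: M_ideal.2.
    exact: adjoint_lie.
  - move=> _ _ [y My <-] [z Mz <-].
    by move: My; rewrite -radM => -[_]; apply.
  move: Mx; rewrite -{1}(minimal_ideal_perfect M_min).
  move: x; apply: lie_commutator_min => [|y z My Mz].
    exact: (subspace_preimage adjoint_linear (lspan_subspace _)).
  apply: sub_lspan; exists (A y), (A z); split; [by exists y | by exists z |].
  exact: adjoint_lie.
have -> : descending M M k = M.
  by elim: k => //= k ->; apply: minimal_ideal_perfect.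
by move=> M_sub; apply/seteqP; split=> // _ ->; case: M_ideal.1.
Qed.

(** The linear form [killing z] on [M] is represented by some [phi v], as the
    Gram matrix [B] is invertible.  The bracket of [phi v - z] with [M] then
    lies in the radical, by invariance. *)
Lemma complement_centralises : minimal_ideal M ->
  forall z, exists v, centralises M (phi v - z).
Proof.
move=> M_min z; have rad0 := killing_nondegenerate M_min.
pose b (i : 'I_d) := phi (delta_mx 0 i).
pose B := \matrix_(i < d, j < d) killing (b i) (b j).
have killing_row w (r : 'rV_d) :
    killing (phi r) w = \sum_i r 0 i * killing (b i) w.
  rewrite {1}(row_sum_delta r) linear_sum.
  have add : {morph (fun x => killing x w) : x y / x + y >-> x + y}.
    by move=> x y; have := killingZDl 1 x y w; rewrite !scale1r mul1r.
  have k0 : killing 0 w = 0 by apply: (linear_at0 (killing_linear w)).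
  rewrite (big_morph _ add k0); apply: eq_bigr => i _; rewrite linearZ.
  by have := killingZDl (r 0 i) (b i) 0 w; rewrite k0 !addr0.
have B_unit : B \in unitmx.
  rewrite -row_free_unit; apply: inj_row_free => r rB0.
  suff : phi r = 0 by rewrite -(linear0 phi) => /phi_inj.
  have : killing_radical (phi r).
    split=> // _ /of_M[u ->]; rewrite killingC killing_row big1 // => i _.
    rewrite killingC killing_row.
    have -> : \sum_j r 0 j * killing (b j) (b i) = (r *m B) 0 i.
      by rewrite mxE; apply: eq_bigr => j _; rewrite [B _ _]mxE.
    by rewrite rB0 mxE mulr0.
  by rewrite rad0.
pose r : 'rV_d := \row_j killing z (b j).
exists (r *m invmx B) => u Mu.
have ortho y : M y -> killing (phi (r *m invmx B) - z) y = 0.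
  move=> /of_M[t ->]; rewrite killingC killing_row big1 // => i _.
  rewrite killingC -[phi (r *m _) - z]addrC -scaleN1r killingZDl mulN1r.
  rewrite killing_row.
  have -> : \sum_j (r *m invmx B) 0 j * killing (b j) (b i) =
      ((r *m invmx B) *m B) 0 i.
    by rewrite mxE; apply: eq_bigr => j _; rewrite [B _ _]mxE.
  by rewrite mulmxKV // mxE addNr mulr0.
suff : killing_radical ⟦u, phi (r *m invmx B) - z⟧ by rewrite rad0.
split=> [|y My]; first exact: M_ideal.2.
rewrite lieC -lieNr killing_invariant ortho // lieNl.
by apply: subspaceN; [case: M_ideal | apply: M_ideal.2].
Qed.
End Adjoint.

Lemma adjoint_matrices M d (phi : {linear 'rV[K]_d -> L}) :
  ideal M -> M = [set phi u | u in setT] ->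
  exists A : L -> 'M[K]_d, forall x u, phi (u *m A x) = ⟦phi u, x⟧.
Proof.
move=> M_ideal M_phi.
suff /choice[A A_phi] : forall x, exists X : 'M[K]_d,
    forall u, phi (u *m X) = ⟦phi u, x⟧.
  by exists A.
move=> x.
have /choice[rows rowsE] : forall i : 'I_d, exists r,
    phi r = ⟦phi (delta_mx 0 i), x⟧.
  move=> i; have : M ⟦phi (delta_mx 0 i), x⟧.
    by apply: M_ideal.2; rewrite M_phi; exists (delta_mx 0 i).
  by rewrite M_phi => -[r _ <-]; exists r.
exists (\matrix_i rows i) => u.
rewrite [in RHS](row_sum_delta u) mulmx_sum_row !linear_sum /=.
rewrite (big_morph (fun y => ⟦y, x⟧) (fun y z => lieDl y z x) (lie0l x)).
by apply: eq_bigr => i _; rewrite rowK !linearZ /= lieZl rowsE.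
Qed.

(** [M] itself is the quotient: [pi z] is the unique [v] such that [phi v] and
    [z] act in the same way on [M], and the bracket of [M] is transported to row
    vectors along [phi]. *)
Lemma minimal_ideal_quotient M : [pchar K] =i pred0 -> minimal_ideal M ->
  exists (S : lieAlgType K) (pi : L -> S),
    [/\ findim [set: S], simple S, lie_morphism pi,
        forall s, exists x, pi x = s & forall x, pi x = 0 -> centralises M x].
Proof.
move=> K0 M_min; have [M_ideal M0 M_fin min_M] := M_min.
have [d [phi [phi_inj M_phi]]] := findim_coordinates M_fin.
have [A A_phi] := adjoint_matrices M_ideal M_phi.
have M_of u : M (phi u) by rewrite M_phi; exists u.
have /choice[pi piE] :=
  complement_centralises M_ideal phi_inj M_phi A_phi K0 M_min.
have pi_uniq z v : centralises M (phi v - z) -> pi z = v.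
  move=> cv; apply/phi_inj/eqP; rewrite -subr_eq0; apply/eqP.
  apply: (centralising_member0 M_ideal).
    by apply: subspaceB; [case: M_ideal | |].
  move=> u Mu; rewrite -[phi (pi z)](subrK z) -addrA lieDr piE // add0r.
  by rewrite -opprB lieNr cv // oppr0.
pose br (u v : 'rV[K]_d) : 'rV[K]_d := u *m A (phi v).
have phi_br u v : phi (br u v) = ⟦phi u, phi v⟧ by apply: A_phi.
have br_linl v : linear (br^~ v).
  by move=> a u w; apply: phi_inj; rewrite linearP !phi_br linearP lie_linearl.
have br_linr u : linear (br u).
  by move=> a v w; apply: phi_inj; rewrite linearP !phi_br linearP lie_linearr.
have br_xx u : br u u = 0 by apply: phi_inj; rewrite phi_br liexx linear0.
have br_jacobi u v w : br u (br v w) + br v (br w u) + br w (br u v) = 0.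
  by apply: phi_inj; rewrite !linearD !phi_br lie_jacobi linear0.
pose lieS :=
  Lmodule_isLieAlgebra.Build K 'rV[K]_d br_linl br_linr br_xx br_jacobi.
pose S : lieAlgType K := HB.pack 'rV[K]_d lieS.
have pi_phi u : pi (phi u) = u by apply: pi_uniq => v _; rewrite subrr lie0r.
exists S, pi; split.
- have := findim_range (idfun : {linear 'rV[K]_d -> S}).
  by rewrite image_id.
- split.
    apply: contrapT => S_ab; apply: M0; apply: abelian_ideal0 => // x y.
    rewrite M_phi => -[u _ <-] [v _ <-]; apply: contrapT => uv.
    apply: S_ab; exists u, v; apply/eqP => br0; apply: uv.
    by rewrite -phi_br -(linear0 phi); congr (phi _).
  move=> I [I_sub I_ideal].
  have phiI_ideal : ideal [set phi u | u in I].
    split; first exact: (subspace_image (linearP phi) I_sub).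
    move=> _ z [u Iu <-]; exists (br u (pi z)); first exact: I_ideal.
    by rewrite phi_br -[phi (pi z)](subrK z) lieDr piE ?add0r.
  have [|phiI0|phiIM] := min_M _ phiI_ideal.
  - by move=> _ [u _ <-].
  - left; apply/seteqP; split=> [u Iu|_ ->]; last exact: I_sub.1.
    have : [set phi u | u in I] (phi u) by exists u.
    by rewrite phiI0 /= -(linear0 phi) => /phi_inj.
  right; apply/seteqP; split=> // u _.
  by have : M (phi u) by []; rewrite -phiIM => -[v Iv /phi_inj <-].
- split=> [a x y|x y]; apply: pi_uniq.
    rewrite linearP opprD addrACA -scalerBr.
    exact: centralisesZD.
  rewrite [phi _]phi_br -[phi (pi x)](subrK x) -[phi (pi y)](subrK y).
  move: (piE x) (piE y).
  set c := phi (pi x) - x; set c' := phi (pi y) - y => cx cy.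
  have -> : ⟦c + x, c' + y⟧ - ⟦x, y⟧ = 1 *: ⟦c, c' + y⟧ - ⟦c', x⟧.
    by rewrite lieDl [⟦x, _⟧]lieDr scale1r [⟦x, c'⟧]lieC -addrA addrK.
  rewrite -scaleN1r; apply: centralisesZD; first exact: centralises_lie.
  rewrite -[_ *: _]addr0; apply: centralisesZD; first exact: centralises_lie.
  by move=> u _; rewrite lie0r.
- by move=> s; exists (phi s).
move=> x x0 u Mu; have := piE x u Mu.
by rewrite x0 linear0 add0r lieNr => /eqP; rewrite oppr_eq0 => /eqP.
Qed.
End MinimalIdeals.

(** * The ideal attached to an almost invariant subalgebra *)
Section StableTerm.
Context {K : fieldType} {L : lieAlgType K}.
Variables (A : set L) (n : nat).
Hypotheses (A_alg : subalgebra A) (A_fin : findim A) (An : ad_power A n `<=` A).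

Local Notation W := (descending [set: L] A).

Lemma whole_subalgebra : subalgebra [set: L]. Proof. by []. Qed.

Lemma descending_setT_decr j k : (j <= k)%N -> W k `<=` W j.
Proof.
move/subnK <-; elim: (k - j)%N => // i IHi x.
by move/(descending_decr whole_subalgebra (@subsetT _ A)) => /IHi.
Qed.

Lemma descending_ad_power k : W k `<=` ad_power A k.
Proof.
elim: k => [|k IHk].
  by move=> x _; apply: sub_lspan; exists x, [tuple]; split=> // y.
apply: lie_commutator_min => [|x a /IHk]; first exact: lspan_subspace.
move: x; apply: lspan_min => [|_ [x [s [sA ->]]] Aa].
  split=> [Aa|c x y Ax Ay Aa].
    by rewrite lie0l; apply: (lspan_subspace _).1.
  by rewrite lie_linearl; apply: (lspan_subspace _).2; [apply: Ax | apply: Ay].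
apply: sub_lspan; exists x, [tuple of rcons s a].
split; last by rewrite foldl_rcons.
by move=> y /=; rewrite mem_rcons inE => /predU1P[->|/sA].
Qed.

(** By induction on [j] from [[z, [w, b]] = [[z, w], b] - [[z, b], w]]: the
    element [b] of [A] raises the level of [z] by one in the last term, which is
    why [z] is allowed an arbitrary level [i].  The shift by [n] is there
    because the elements of level [n] lie in [A]. *)
Lemma lie_descending j a :
  W (n + j) a -> forall i z, W i z -> W (i + j).+1 ⟦z, a⟧.
Proof.
have sW k : subspace (W k) := descending_subspace whole_subalgebra A k.
elim: j a => [|j IHj] a.
  rewrite !addn0 => /descending_ad_power/An Aa i z Wz; rewrite addn0.
  exact: mem_lie_commutator.
rewrite addnS => aW i z Wz; move: a aW.
apply: lie_commutator_min => [|w b Ww Ab].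
  exact: (subspace_preimage (lie_linearr z) (sW _)).
have -> : ⟦z, ⟦w, b⟧⟧ = ⟦⟦z, w⟧, b⟧ - ⟦⟦z, b⟧, w⟧.
  by rewrite (lie_leibniz z w b) addrAC subrr add0r.
apply: (subspaceB (sW _)); rewrite addnS.
  by apply: mem_lie_commutator => //; apply: IHj.
by rewrite -addSn; apply: IHj => //; apply: mem_lie_commutator.
Qed.

(** A term [W k] of minimal dimension among those with [k >= n], which are
    contained in [A], is contained in every [W j]; so [lie_descending] applies
    to its elements with an arbitrary [j]. *)
Lemma stable_term : exists k, ideal (W k) /\ findim (W k).
Proof.
have sW k : subspace (W k) := descending_subspace whole_subalgebra A k.
have WA k : (n <= k)%N -> W k `<=` A.
  by move=> nk x /(descending_setT_decr nk)/descending_ad_power/An.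
pose P := [set B : set L | exists2 k, (n <= k)%N & B = W k].
have [||_ [k nk ->] k_min] := @findim_minimal _ _ A P A_fin.
- by move=> _ [k nk ->]; split=> //; apply: WA.
- by exists (W n), n.
exists k; split; last exact: findim_subspace A_fin (sW k) (WA k nk).
have le_W j : W k `<=` W j.
  have [jk|/ltnW kj] := leqP j k; first exact: descending_setT_decr.
  apply: k_min; last exact: descending_setT_decr.
  by exists j => //; apply: leq_trans kj.
split=> // x z Wx; rewrite lieC; apply: subspaceN => //.
have /lie_descending : W (n + k) x by apply: le_W Wx.
move=> /(_ 0%N z I); rewrite add0n; exact: descending_setT_decr.
Qed.

Lemma derived_series_descending B k : B `<=` A -> subalgebra B ->
  derived_series B k `<=` W k `&` B.
Proof.
move=> BA B_alg; elim: k => [|k IHk]; first by move=> x Bx; split.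
have sW j : subspace (W j) := descending_subspace whole_subalgebra A j.
apply: lie_commutator_min => [|x y /IHk[Wx Bx] /IHk[_ By]].
  exact: subspaceI (sW k.+1) B_alg.1.
by split; [apply: mem_lie_commutator => //; apply: BA | apply: B_alg.2].
Qed.

End StableTerm.

(** * Subdirect decomposition *)

(** The elements centralising all minimal ideals form an ideal [N], which is
    locally solvable: the part of [N] in a subalgebra [A] as in the hypothesis
    has its derived series in [W k] and in [N], and these meet in [0]. *)
Lemma common_centraliser0 (K : fieldType) (L : lieAlgType K) :
  semisimple L ->
  (forall X : set L, finite_set X ->
      exists A : set L, [/\ subalgebra A, findim A, X `<=` A &
        exists n : nat, (0 < n)%N /\ ad_power A n `<=` A]) ->
  forall x : L, (forall M, minimal_ideal M -> centralises M x) -> x = 0.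
Proof.
move=> L_ss hL x x_cent.
pose N := [set x : L | forall M, minimal_ideal M -> centralises M x].
suff N0 : N = [set 0] by have : N x by []; rewrite N0.
have N_ideal : ideal N.
  split=> [|y z Ny M M_min]; last first.
    by apply: centralises_lie; [case: M_min | apply: Ny].
  split=> [M M_min u _|a y z Ny Nz M M_min]; first by rewrite lie0r.
  by apply: centralisesZD; [apply: Ny | apply: Nz].
apply: (L_ss N) => // X X_fin XN.
have [A [A_alg A_fin XA [n [_ An]]]] := hL X X_fin.
have B_alg : subalgebra (A `&` N).
  split=> [|y z [Ay Ny] [Az _]]; first exact: subspaceI A_alg.1 N_ideal.1.
  by split; [apply: A_alg.2 | apply: N_ideal.2].
exists (A `&` N); split; [exact: B_alg | by move=> y [] | |];
  last by move=> y Xy; split; [apply: XA | apply: XN].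
have [k [W_ideal W_fin]] := stable_term A_fin An.
set W := descending _ _ k in W_ideal W_fin.
have WN_ideal : ideal (W `&` N).
  split=> [|y z [Wy Ny]]; first exact: subspaceI W_ideal.1 N_ideal.1.
  by split; [apply: W_ideal.2 | apply: N_ideal.2].
have WN0 : W `&` N = [set 0].
  apply: contrapT => WN_neq0.
  have [|M M_min MWN] := exists_minimal_ideal WN_ideal _ WN_neq0.
    by apply: findim_subspace W_fin _ _; [case: WN_ideal | move=> y []].
  have [M_ideal M0 _ _] := M_min; apply: M0.
  apply: (abelian_ideal0 L_ss) => // y z My Mz.
  by have [_ /(_ M M_min)] := MWN z Mz; apply.
exists k; apply/seteqP; split=> [y|_ ->].
  move/(@derived_series_descending _ _ A _ k (@subIsetl _ A N) B_alg).
  by move=> [Wy [_ Ny]]; rewrite -WN0.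
case: k {W W_ideal W_fin WN_ideal WN0} => [|k]; first exact: B_alg.1.1.
exact: (lie_commutator_subspace _ _).1.
Qed.

Theorem theorem6 (K : fieldType) (charK : [pchar K] =i pred0)
    (L : lieAlgType K) (L_semisimple : semisimple L)
    (L_locfin : locally_finite L)
    (hL : forall X : set L, finite_set X ->
      exists A : set L, [/\ subalgebra A, findim A, X `<=` A &
        exists n : nat, (0 < n)%N /\ ad_power A n `<=` A]) :
  exists (J : Type) (S : J -> lieAlgType K),
    (forall j, findim [set: S j] /\ simple (S j)) /\ subdirect_sum L S.
Proof.
pose J := {M : set L | minimal_ideal M}.
have /choice[F F_quo] : forall j : J, exists F : {S : lieAlgType K & L -> S},
    [/\ findim [set: projT1 F], simple (projT1 F), lie_morphism (projT2 F),
        forall s, exists x, projT2 F x = s &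
        forall x, projT2 F x = 0 -> centralises (sval j) x].
  move=> j.
  have [S [pi quo]] := minimal_ideal_quotient L_semisimple charK (svalP j).
  by exists (existT _ S pi).
pose S j := projT1 (F j); exists J, S; split=> [j|]; first by case: (F_quo j).
pose f (x : L) : lie_prod S := fun j => projT2 (F j) x.
have f_lin : linear f.
  move=> a x y; apply: functional_extensionality_dep => j.
  by have [_ _ [lin _] _ _] := F_quo j; apply: lin.
have f_lie : {morph f : x y / ⟦x, y⟧}.
  move=> x y; apply: functional_extensionality_dep => j.
  by have [_ _ [_ lie] _ _] := F_quo j; apply: lie.
have f_inj x y : f x = f y -> x = y.
  move=> fxy; apply/eqP; rewrite -subr_eq0; apply/eqP.
  apply: (common_centraliser0 L_semisimple hL) => M M_min.
  have fB : f (x - y) = 0 by rewrite addrC -scaleN1r f_lin fxy scaleN1r addNr.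
  have [_ _ _ _ ker] := F_quo (exist _ M M_min); apply: ker.
  exact: (congr1 (fun g : lie_prod S => g (exist _ M M_min)) fB).
exists (range f); split.
- split; first by apply: (subspace_image f_lin).
  by move=> _ _ [x _ <-] [y _ <-]; exists ⟦x, y⟧ => //; apply: f_lie.
- move=> j; apply/seteqP; split=> // s _.
  have [_ _ _ /(_ s)[x xs] _] := F_quo j.
  by exists (f x) => //; exists x.
exists f; split=> //; split=> [x _|x y _ _ /f_inj //|_ [x _ <-]]; by exists x.
Qed.
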